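(* Let $q$ be a prime power, let $d\geq 2$ be an integer such that $d\not\equiv 0\pmod 4$, and let $f(x)=x^{d}-a\in\mathbb{F}_q[x]$. Let $n_0<m_0$ be the minimal positive integers such that $P_{n_0}(a)=P_{m_0}(a)$ (first $n_0$ is chosen minimal such that $P_{n_0}(a)=P_m(a)$ for some $m>n_0$, and then $m_0>n_0$ is chosen minimal such that $P_{n_0}(a)=P_{m_0}(a)$). Then $f(x)$ is stable over $\mathbb{F}_q$ if and only if for every prime number $l\mid d$ and every $k\in\{1,\ldots,m_0-1\}$, $P_k(a)\notin\mathbb{F}_q^{l}$.
   Context: $\mathbb{F}_q$ is the finite field with $q$ elements. For the fixed integer $d\ge 2$, the polynomials $P_n(x)$, $n\geq 1$, are defined inductively by $P_1(x)=x$ and $P_n(x)=[P_{n-1}(x)]^{d}+(-1)^{d-1}x$ for $n\geq 2$. $\mathbb{F}_q^{l}=\{b^l : b\in\mathbb{F}_q\}$ is the set of $l$-th powers, including $0$; in particular $P_k(a)\notin\mathbb{F}_q^{l}$ implies $P_k(a)\neq 0$. The iterates of $f$ are $f_0(x)=x$, $f_1(x)=f(x)$, $f_n(x)=f_{n-1}(f(x))$ for $n\geq 2$; $f$ is stable over a field $K$ if $f_n(x)$ is irreducible over $K$ for all $n\ge 0$. *)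

(* Defs.v *)
From HB Require Import structures.
From mathcomp Require Import all_boot all_order all_algebra.

Set Implicit Arguments.
Unset Strict Implicit.
Unset Printing Implicit Defensive.

Import GRing.Theory.
Local Open Scope ring_scope.

(* The sequence starts at index 1; [Pseq R d 0] is a junk value ('X). *)
Definition Pseq (R : comNzRingType) (d n : nat) : {poly R} :=
  iter n.-1 (fun p : {poly R} => p ^+ d + (-1) ^+ d.-1 *: 'X) 'X.

Fixpoint poly_iter (R : comNzRingType) (f : {poly R}) (n : nat) : {poly R} :=
  if n is m.+1 then poly_iter f m \Po f else 'X.

Definition stable (K : fieldType) (f : {poly K}) : Prop :=
  forall n : nat, irreducible_poly (poly_iter f n).

Definition powers (F : finFieldType) (l : nat) : {set F} :=
  [set b ^+ l | b : F].

(* [n0] is minimised first, over all repetitions; [m0] is then minimised for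
   that [n0]. Indices are positive. *)
Definition first_repetition (T : Type) (u : nat -> T) (n0 m0 : nat) : Prop :=
  [/\ (0 < n0 < m0)%N,
      u n0 = u m0,
      forall n m : nat, (0 < n < m)%N -> u n = u m -> (n0 <= n)%N
    & forall m : nat, (n0 < m)%N -> u n0 = u m -> (m0 <= m)%N].

(* Main.v *)
Require Import Defs.
From HB Require Import structures.
From mathcomp Require Import all_boot all_order all_algebra.
From mathcomp Require Import fingroup cyclic falgebra fieldext galois finfield.
From mathcomp Require Import zify.

Set Implicit Arguments.
Unset Strict Implicit.
Unset Printing Implicit Defensive.

Import GRing.Theory.
Local Open Scope ring_scope.

(** Let q be the order of F, f = X^d - a, and f_n the iterates of f. The theorem
    follows from a statement about one step: if f_n is irreducible and every
    prime divisor l of d divides q - 1, then f_(n+1) is irreducible if and only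
    if P_(n+1)(a) is not an l-th power for any prime l dividing d
    ([irreducible_comp_XnsubC], [irreducible_iff_powers]). The condition on
    q - 1 follows from either side of the theorem, since each of them implies
    that a = P_1(a) is not an l-th power, whereas every element of F is an l-th
    power when l does not divide q - 1.

    For the step, let b be a root of f_(n+1) in a splitting field. Then
    x = b^d - a is a root of f_n, of degree r = d^n, and f_(n+1) is irreducible
    if and only if b has degree rd over F. The Frobenius detects degrees:
    b^(q^m) = b if and only if the degree of b divides m ([expr_card_fix]). For
    b nonzero, Q = q^r and z = b^(Q-1), the exponents m that fix b are the rt
    with z^(1+Q+...+Q^(t-1)) = 1. The element a + x = b^d has norm P_(n+1)(a)
    over F ([norm_addr_root], [Pseq_poly_iter]), and this norm is its power with
    exponent (Q-1)/(q-1). Hence z^(d/l) = P_(n+1)(a)^((q-1)/l) for each prime l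
    dividing d, and z has order exactly d if and only if P_(n+1)(a) is not an
    l-th power for any such l. What remains is arithmetic: since Q is 1 modulo
    the prime divisors of d, d divides 1+Q+...+Q^(d-1)
    ([dvdn_geom_sum_self]), and, since 4 does not divide d, d divides
    1+Q+...+Q^(t-1) only if d divides t ([dvdn_geom_sum]).

    Finally the sequence P_k(a) obeys a first-order recursion, so that its
    values are all reached before the first repetition ([repetition_values]). *)

(** * Divisibility of geometric sums *)

Definition geom_sum (Q t : nat) : nat := (\sum_(i < t) Q ^ i)%N.

Lemma geom_sumM (Q s t : nat) :
  (1 < Q)%N -> geom_sum Q (s * t) = (geom_sum Q s * geom_sum (Q ^ s) t)%N.
Proof.
move=> Q1; apply/eqP; rewrite -(@eqn_pmul2l Q.-1); last by lia.
by rewrite mulnA /geom_sum -!predn_exp expnM.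
Qed.

Lemma geom_sum_mod (l Q t : nat) :
  (Q = 1 %[mod l])%N -> (geom_sum Q t = t %[mod l])%N.
Proof.
move=> Q1; rewrite /geom_sum -modn_summ (eq_bigr (fun=> 1 %% l)%N); last first.
  by move=> i _; rewrite -modnXm Q1 modnXm exp1n.
by rewrite modn_summ sum1_card card_ord.
Qed.

Lemma mod1_dvd_pred (l Q : nat) :
  (0 < Q)%N -> (l %| Q.-1)%N -> (Q = 1 %[mod l])%N.
Proof. by move=> Q0 lQ; apply/eqP; rewrite eqn_mod_dvd // subn1. Qed.

Lemma dvdn_pred_exp (l Q r : nat) : (l %| Q.-1)%N -> (l %| (Q ^ r).-1)%N.
Proof. by move=> h; rewrite predn_exp dvdn_mulr. Qed.

(** Modulo l^2, writing Q = 1 + ul, each Q^i is 1 + iul, so the sum is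
    l + ul * l(l-1)/2, which is congruent to l because the odd prime l divides
    its binomial coefficient l(l-1)/2. This fails for l = 2 and Q = 3 mod 4. *)
Lemma prime_sq_ndvd_geom_sum (l Q : nat) :
  prime l -> odd l -> (l %| Q.-1)%N -> (0 < Q)%N ->
  ~~ (l ^ 2 %| geom_sum Q l)%N.
Proof.
move=> pl ol /dvdnP[u Eu] Q0.
have l2 : (2 < l)%N by apply: odd_prime_gt2.
have EQ : Q = (1 + u * l)%N by lia.
have Qi i : (Q ^ i = 1 + i * (u * l) %[mod l ^ 2])%N.
  elim: i => [|i IH]; first by rewrite expn0 mul0n addn0.
  rewrite expnS -modnMmr IH modnMmr EQ.
  have ->: ((1 + u * l) * (1 + i * (u * l))
            = (i * u * u) * l ^ 2 + (1 + i.+1 * (u * l)))%N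
    by rewrite expnS expn1; nia.
  by rewrite modnMDl.
have: (geom_sum Q l = l %[mod l ^ 2])%N.
  rewrite /geom_sum -modn_summ.
  rewrite (eq_bigr (fun i : 'I_l => (1 + i * (u * l)) %% l ^ 2)%N); last first.
    by move=> i _; rewrite Qi.
  rewrite modn_summ big_split /= sum1_card card_ord -big_distrl /=.
  rewrite -(big_mkord xpredT id) bin2_sum.
  have /dvdnP[w ->] : (l %| 'C(l, 2))%N by apply: prime_dvd_bin; lia.
  have ->: (w * l * (u * l) = (w * u) * l ^ 2)%N by rewrite expnS expn1; nia.
  by rewrite addnC modnMDl.
move=> E; apply/negP => /eqP; rewrite E modn_small ?expnS ?expn1; first by lia.
by nia.
Qed.

(** By induction on d, splitting off a prime l: both factors of
    [geom_sum Q (l * d')], as given by [geom_sumM], fall under the hypothesis,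
    since Q^l is again 1 modulo the primes dividing d. *)
Lemma dvdn_geom_sum_self (Q d : nat) : (1 < Q)%N -> (0 < d)%N ->
  (forall l, prime l -> (l %| d)%N -> (l %| Q.-1)%N) -> (d %| geom_sum Q d)%N.
Proof.
elim/ltn_ind: d Q => d IH Q Q1 d0 hd.
have [d1|d1] := leqP d 1; first by have ->: d = 1%N by lia.
have pl := pdiv_prime d1; set l := pdiv d in pl.
have ld : (l %| d)%N by apply: pdiv_dvd.
have [d' Ed] := dvdnP ld; rewrite mulnC in Ed.
have l1 := prime_gt1 pl.
have Qm : (Q = 1 %[mod l])%N by apply: mod1_dvd_pred; [lia | apply: hd].
rewrite [in X in (_ %| X)%N]Ed geom_sumM // {1}Ed dvdn_mul //.
  by rewrite /dvdn geom_sum_mod // modnn.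
have d'0 : (0 < d')%N by move: d0; rewrite Ed muln_gt0 => /andP[].
apply: IH => //; first by rewrite Ed ltn_Pmull.
  by rewrite -(exp1n l) ltn_exp2r // ltnW.
move=> k pk kd; apply/dvdn_pred_exp/hd => //.
by rewrite Ed dvdn_mull.
Qed.

(** A form of lifting the exponent. A prime l dividing d divides t, as the sum
    is t modulo l. In [geom_sum Q (l * t')], the first factor of [geom_sumM]
    absorbs exactly one l and no other prime of d, so that the rest of d divides
    [geom_sum (Q ^ l) t'] and induction applies. *)
Lemma dvdn_geom_sum (Q d t : nat) : (1 < Q)%N -> ~~ (4 %| d)%N ->
  (forall l, prime l -> (l %| d)%N -> (l %| Q.-1)%N) ->
  (d %| geom_sum Q t)%N -> (d %| t)%N.
Proof.
elim/ltn_ind: d Q t => d IH Q t Q1 d4 hd.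
have [d1|d1] := leqP d 1.
  move=> _; have [d_0|->] : d = 0%N \/ d = 1%N by lia.
    by rewrite d_0 in d4.
  exact: dvd1n.
have pl := pdiv_prime d1; set l := pdiv d in pl.
have ld : (l %| d)%N by apply: pdiv_dvd.
have [d' Ed] := dvdnP ld.
have l1 := prime_gt1 pl.
have Q0 : (0 < Q)%N by lia.
have lQ := hd l pl ld.
have Qm : (Q = 1 %[mod l])%N by apply: mod1_dvd_pred.
move=> dS.
have /dvdnP[t' Et] : (l %| t)%N.
  by have := dvdn_trans ld dS; rewrite /dvdn geom_sum_mod.
have /dvdnP[w Ew] : (l %| geom_sum Q l)%N.
  by rewrite /dvdn geom_sum_mod // modnn.
have ld' : (l %| d')%N -> odd l.
  move=> h; case: (even_prime pl) => // l_2; case/negP: d4.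
  by rewrite Ed -[4%N]/(2 * 2)%N -{1 2}l_2 dvdn_mul.
(* a common prime p divides geom_sum Q l, which is l mod p: hence p = l *)
have cop : coprime d' w.
  rewrite /coprime; case: (ltngtP (gcdn d' w) 1) => // g1.
    have d'0 : (0 < d')%N by move: (ltnW d1); rewrite Ed muln_gt0 => /andP[].
    by move: g1; rewrite ltnNge gcdn_gt0 d'0.
  have pp := pdiv_prime g1; set p := pdiv _ in pp.
  have := pdiv_dvd (gcdn d' w); rewrite -/p dvdn_gcd => /andP[pd' pw].
  have pd : (p %| d)%N by rewrite Ed dvdn_mulr.
  have Qmp : (Q = 1 %[mod p])%N by apply: mod1_dvd_pred => //; apply: hd.
  have : (p %| geom_sum Q l)%N by rewrite Ew dvdn_mulr.
  rewrite /dvdn geom_sum_mod // -/(dvdn p l) dvdn_prime2 // => /eqP pl'.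
  rewrite pl' in pd' pw.
  have /negP[] := prime_sq_ndvd_geom_sum pl (ld' pd') lQ Q0.
  by rewrite Ew expnS expn1 dvdn_mul.
have d'S : (d' %| geom_sum (Q ^ l) t')%N.
  rewrite -(Gauss_dvdr _ cop) -(@dvdn_pmul2r l); last by lia.
  by move: dS; rewrite Et Ed [(t' * l)%N]mulnC geom_sumM // Ew mulnAC.
rewrite Ed Et dvdn_mul //; apply: IH d'S.
- by rewrite Ed ltn_Pmulr // -(ltn_pmul2r (ltnW l1)) mul0n -Ed ltnW.
- by rewrite -(exp1n l) ltn_exp2r // ltnW.
- by apply: contra d4 => h; rewrite Ed dvdn_mulr.
- by move=> k pk kd'; apply/dvdn_pred_exp/hd; rewrite // Ed dvdn_mulr.
Qed.

(** * Powers in a finite field *)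

Lemma expf_card_pred (F : finFieldType) (x : F) : x != 0 -> x ^+ #|F|.-1 = 1.
Proof.
move=> x0; apply: (mulfI x0); rewrite -exprS prednK ?expf_card ?mulr1 //.
exact: ltnW (finNzRing_gt1 F).
Qed.

(** The multiplicative group is cyclic of order q - 1: if g is a
    generator, (g^i)^((q-1)/l) is 1 exactly when l divides i. *)
Lemma in_powers (F : finFieldType) (l : nat) (x : F) :
  (l %| #|F|.-1)%N -> x != 0 ->
  (x \in powers F l) = (x ^+ (#|F|.-1 %/ l) == 1).
Proof.
set n := #|F|.-1 => ln x0.
have n0 : (0 < n)%N by rewrite /n -subn1 subn_gt0 finNzRing_gt1.
have l0 : (0 < l)%N by apply: dvdn_gt0 ln.
apply/imsetP/eqP => [[b _ Ex] | x1].
  have b0 : b != 0 by apply: contra x0 => /eqP b0; rewrite Ex b0 expr0n gtn_eqF.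
  by rewrite Ex -exprM mulnC divnK // expf_card_pred.
have /hasP[g _ gP] : has n.-primitive_root [seq y <- enum F | y != 0].
  apply: has_prim_root => //.
  - apply/allP => y; rewrite mem_filter => /andP[y0 _].
    by rewrite unity_rootE expf_card_pred.
  - by rewrite filter_uniq // enum_uniq.
  rewrite size_filter /n -(cardC1 (0 : F)) cardE -size_filter /enum_mem.
  rewrite size_filter size_filter count_filter; apply/eq_leq/eq_count => y.
  by rewrite /= !inE andbT.
have [[i Hi] /= Ei] := prim_rootP gP (expf_card_pred x0).
move: x1; rewrite Ei -exprM => /eqP; rewrite -(prim_order_dvd gP).
rewrite -{1}(divnK ln) mulnC dvdn_pmul2r; last first.
  by rewrite divn_gt0 // dvdn_leq.
by move=> /dvdnP[j ->]; exists (g ^+ j); rewrite // exprM.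
Qed.

Lemma powers_full (F : finFieldType) (l : nat) (x : F) :
  prime l -> ~~ (l %| #|F|.-1)%N -> x \in powers F l.
Proof.
move=> pl nl; apply/imsetP; have l0 := prime_gt0 pl.
have [->|x0] := eqVneq x 0; first by exists 0; rewrite // expr0n gtn_eqF.
have [u v E _] := egcdnP #|F|.-1 l0.
have g1 : gcdn l #|F|.-1 = 1%N.
  by apply/eqP; rewrite -/(coprime _ _) prime_coprime.
exists (x ^+ u) => //; rewrite -exprM E g1 addn1 exprS mulnC exprM.
by rewrite expf_card_pred // expr1n mulr1.
Qed.

(** * Roots and the Frobenius *)

Local Notation "p ^%:A" := (map_poly (in_alg _) p)
  (at level 2, format "p ^%:A") : ring_scope.

Lemma in_algX_card (F : finFieldType) (L : fieldExtType F) (x : F) (i : nat) :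
  (x%:A : L) ^+ (#|F| ^ i) = x%:A.
Proof.
elim: i => [|i IH]; first by rewrite expr1.
by rewrite expnSr exprM IH -[x%:A]/(in_alg L x) -rmorphXn /= expf_card.
Qed.

Lemma exprDn_card (F : finFieldType) (L : fieldExtType F) (x y : L) (i : nat) :
  (x + y) ^+ (#|F| ^ i) = x ^+ (#|F| ^ i) + y ^+ (#|F| ^ i).
Proof.
apply: exprDn_pchar; rewrite pnatX; apply/orP; left.
have [p pp pF] := finPcharP F.
rewrite (card_pprimeChar pF) pnatX pnatE // pchar_lalg pF //.
Qed.

(** The Frobenius of L is a ring morphism that fixes the coefficients of p. *)
Lemma horner_alg_card (F : finFieldType) (L : fieldExtType F) (p : {poly F})
  (x : L) (i : nat) :
  (p^%:A).[x ^+ (#|F| ^ i)] = (p^%:A).[x] ^+ (#|F| ^ i).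
Proof.
elim/poly_ind: p => [|p c IH].
  rewrite rmorph0 !horner0 expr0n gtn_eqF // expn_gt0.
  by rewrite (ltnW (finNzRing_gt1 F)).
rewrite rmorphD rmorphM /= map_polyX map_polyC !hornerMXaddC IH.
by rewrite exprDn_card exprMn in_algX_card.
Qed.

(** The Frobenius generates the Galois group of F(x) over F, its order is the
    degree of x, and an automorphism of F(x) fixing x is the identity. *)
Lemma expr_card_fix (F : finFieldType) (L : splittingFieldType F)
  (x : L) (m : nat) :
  (x ^+ (#|F| ^ m) == x) = (adjoin_degree 1%AS x %| m)%N.
Proof.
have [g genG gE] := finField_galois_generator (subv_adjoin 1%AS x).
have g_in : g \in 'Gal(<<1; x>> / 1%AS)%g.
  by rewrite (eqP genG) cycle_id.
rewrite adjoin_degreeE galois_dim; last first.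
  exact: finField_galois (subv_adjoin _ _).
rewrite (eqP genG) -/(order g) order_dvdn.
rewrite (gal_adjoin_eq (groupX m g_in) (group1 _)) gal_id.
suff -> : (g ^+ m)%g x = x ^+ (#|F| ^ m) by [].
elim: m => [|m IH]; first by rewrite expg0 gal_id expr1.
rewrite expgSr galM ?memv_adjoin // IH gE ?rpredX ?memv_adjoin //.
by rewrite dimv1 expn1 -exprM -expnSr.
Qed.

Lemma irreducible_adjoin_degree (F : fieldType) (L : fieldExtType F)
  (p : {poly F}) (x : L) :
  p \is monic -> root p^%:A x ->
  irreducible_poly p <-> adjoin_degree 1%AS x = (size p).-1.
Proof.
move=> mp px.
have /polyOver1P[m Em] := minPolyOver 1%AS x.
have sm : size m = (adjoin_degree 1%AS x).+1.
  by rewrite -(size_minPoly 1%AS x) Em size_map_poly.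
have dmp : m %| p.
  rewrite -(dvdp_map (in_alg L)) -Em; apply: minPoly_dvdp => //.
  by apply/polyOver1P; exists p.
have p0 : (0 < size p)%N by rewrite size_poly_gt0 monic_neq0.
split=> [[_ irr] | deg].
  by rewrite -(eqp_size (irr m _ dmp)) sm.
have smp : size m = size p by rewrite sm deg prednK.
have emp : m %= p by rewrite -dvdp_size_eqp // smp.
split; first by rewrite -smp sm.
move=> g sg gp.
have gm : g %| m by rewrite (eqp_dvdr _ emp).
have := @minPoly_irr _ _ 1%AS x g^%:A; rewrite Em dvdp_map => /(_ _ gm).
case/(_ _)/orP; first by apply/polyOver1P; exists g.
  by rewrite eqp_map => /eqp_trans; apply.
by move=> /eqp_size; rewrite size_map_poly size_poly1 => sg1; rewrite sg1 in sg.
Qed.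

(** With r the degree of p, hence of x, the q^i-th powers of x for i < r are
    distinct roots of p, which has no room for more. *)
Lemma irreducible_conjugates (F : finFieldType) (L : splittingFieldType F)
  (p : {poly F}) (x : L) :
  p \is monic -> root p^%:A x -> irreducible_poly p ->
  p^%:A = \prod_(i < (size p).-1) ('X - (x ^+ (#|F| ^ i))%:P).
Proof.
move=> mp px irr; have /(irreducible_adjoin_degree mp px) deg := irr.
have p1 : (1 < size p)%N by case: irr.
set r := (size p).-1 in deg *.
set rs := [seq x ^+ (#|F| ^ i) | i <- iota 0 r].
have rsE : size rs = r by rewrite size_map size_iota.
rewrite (@all_roots_prod_XsubC _ p^%:A rs).
- rewrite lead_coef_map (monicP mp) rmorph1 scale1r big_map.
  rewrite -(big_mkord xpredT (fun i => 'X - (x ^+ (#|F| ^ i))%:P)).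
  by rewrite /index_iota subn0.
- by rewrite rsE size_map_poly prednK // ltnW.
- apply/allP => _ /mapP[i _ ->]; rewrite /root horner_alg_card (rootP px).
  by rewrite expr0n gtn_eqF // expn_gt0 (ltnW (finNzRing_gt1 F)).
rewrite uniq_rootsE map_inj_in_uniq ?iota_uniq //.
suff main i j : (i <= j < r)%N -> x ^+ (#|F| ^ i) = x ^+ (#|F| ^ j) -> i = j.
  move=> i j; rewrite !mem_iota !add0n => /andP[_ ir] /andP[_ jr] E.
  by case: (leqP i j) => ij; [|symmetry]; apply: main; rewrite ?ij ?(ltnW ij).
move=> /andP[ij jr] E.
(* raising to the power q^(r-i) turns the i-th conjugate into x itself *)
have xr : x ^+ (#|F| ^ r) = x by apply/eqP; rewrite expr_card_fix deg.
have : x ^+ (#|F| ^ (r + (j - i))) == x.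
  rewrite -[X in _ == X]xr -[in X in _ == X](@subnKC i r); last by lia.
  have -> : (r + (j - i) = j + (r - i))%N by lia.
  by rewrite !expnD !exprM E.
rewrite expr_card_fix deg dvdn_addr // => /dvdn_leq.
by case: (posnP (j - i)) => [|_ /(_ isT)]; lia.
Qed.

(** Both sides are the norm of a + x from F(x) to F: on the left the product of
    the conjugates a + x^(q^i) is a power of a + x by additivity of the
    Frobenius, on the right it is read off the factorisation of p at -a. *)
Lemma norm_addr_root (F : finFieldType) (L : splittingFieldType F)
  (p : {poly F}) (x : L) (a : F) :
  p \is monic -> root p^%:A x -> irreducible_poly p ->
  (a%:A + x) ^+ geom_sum #|F| (size p).-1 = ((-1) ^+ (size p).-1 * p.[- a])%:A.
Proof.
move=> mp px irr.
have -> : ((-1) ^+ (size p).-1 * p.[- a])%:A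
          = (-1) ^+ (size p).-1 * (p^%:A).[- a%:A] :> L.
  by rewrite -[LHS]/(in_alg L _) rmorphM rmorphXn rmorphN1 -horner_map rmorphN.
rewrite (irreducible_conjugates mp px irr) horner_prod.
set r := (size p).-1.
rewrite -[in X in X * _](card_ord r) -prodr_const -big_split /=.
rewrite /geom_sum expr_sum; apply: eq_bigr => i _.
by rewrite exprDn_card in_algX_card hornerXsubC mulN1r opprB opprK addrC.
Qed.

(** * The irreducibility criterion for a composition with X^d - a *)

Lemma primitive_root_prime_test (R : nzRingType) (z : R) (d : nat) :
  (0 < d)%N -> z ^+ d = 1 ->
  (forall l, prime l -> (l %| d)%N -> z ^+ (d %/ l) != 1) ->
  d.-primitive_root z.
Proof.
move=> d0 zd hz; have [m mz /dvdnP[k Ed]] := prim_order_exists d0 zd.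
have [k1|k1] := leqP k 1.
  by case: k k1 Ed d0 => [|[|//]] _ -> //; rewrite mul1n.
have ld : (pdiv k %| d)%N by rewrite Ed dvdn_mulr ?pdiv_dvd.
have /negP[] := hz _ (pdiv_prime k1) ld.
rewrite -(prim_order_dvd mz) Ed -[X in (X * m)%N](divnK (pdiv_dvd k)).
by rewrite mulnAC mulnK ?pdiv_gt0 // dvdn_mull.
Qed.

Lemma expr_pow_fix (K : fieldType) (x : K) (Q t : nat) : x != 0 -> (0 < Q)%N ->
  (x ^+ (Q ^ t) == x) = ((x ^+ Q.-1) ^+ geom_sum Q t == 1).
Proof.
move=> x0 Q0; rewrite -exprM /geom_sum -predn_exp.
rewrite -{1}(@prednK (Q ^ t)) ?expn_gt0 ?Q0 // exprS.
by rewrite -[X in _ == X]mulr1 (inj_eq (mulfI x0)).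
Qed.

(** Capelli's criterion with the condition transported from F(x) to F, where x
    is a root of g and r its degree. Take a root b of the composition with
    b^d = a + x, and let Q = q^r be the order of F(x). Then b^(Q^t) = b amounts
    to z^(1+Q+...+Q^(t-1)) = 1 with z = b^(Q-1), so the degree of b is
    controlled by the order of z, which divides d. As the norm of a + x is
    P = (-1)^r g(-a), the power z^(d/l) is P^((q-1)/l), which is 1 precisely
    when P is an l-th power. *)
Lemma irreducible_comp_XnsubC (F : finFieldType) (d : nat) (a : F)
  (g : {poly F}) :
  (1 < d)%N -> ~~ (4 %| d)%N ->
  (forall l, prime l -> (l %| d)%N -> (l %| #|F|.-1)%N) ->
  g \is monic -> irreducible_poly g ->
  irreducible_poly (g \Po ('X^d - a%:P)) <->
  (forall l, prime l -> (l %| d)%N ->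
     (-1) ^+ (size g).-1 * g.[- a] \notin powers F l).
Proof.
move=> d1 d4 hq mg irr; have d0 := ltnW d1.
set P := _ * _; set h := g \Po _; set r := (size g).-1.
have r0 : (0 < r)%N by rewrite /r -subn1 subn_gt0; case: irr.
have q1 : (1 < #|F|)%N := finNzRing_gt1 F.
set Q := (#|F| ^ r)%N.
have Q1 : (1 < Q)%N by rewrite -(exp1n r) ltn_exp2r.
have hQ l : prime l -> (l %| d)%N -> (l %| Q.-1)%N.
  by move=> pl ld; apply/dvdn_pred_exp/hq.
have sf : size ('X^d - a%:P) = d.+1 by rewrite size_XnsubC.
have mh : h \is monic.
  rewrite monicE lead_coef_comp ?sf // lead_coefXnsubC // (monicP mg).
  by rewrite mul1r expr1n.
have sh : (size h).-1 = (r * d)%N by rewrite size_comp_poly sf.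
have [L [rs Ers _]] := FinSplittingFieldFor (monic_neq0 mh).
have [b hb] : exists b : L, root h^%:A b.
  case: rs Ers => [|b rs] Ers; last first.
    by exists b; rewrite (eqp_root Ers) big_cons rootM root_XsubC eqxx.
  move/eqp_size: Ers; rewrite big_nil size_poly1 size_map_poly => sh1.
  by move: sh; rewrite sh1 /=; nia.
set x := b ^+ d - a%:A.
have gx : root g^%:A x.
  move: hb; rewrite /h map_comp_poly /root horner_comp.
  by rewrite rmorphB /= map_polyXn map_polyC !hornerE.
have Eb : b ^+ d = a%:A + x by rewrite addrC subrK.
have norm : (b ^+ d) ^+ geom_sum #|F| r = P%:A by rewrite Eb norm_addr_root.
have degx : adjoin_degree 1%AS x = r by apply/(irreducible_adjoin_degree mg gx).
have zE l : (l %| d)%N -> (l %| #|F|.-1)%N ->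
    (b ^+ Q.-1) ^+ (d %/ l) = (P ^+ (#|F|.-1 %/ l))%:A.
  move=> ld lq; have l0 := dvdn_gt0 d0 ld.
  rewrite -[RHS]/(in_alg L _) rmorphXn /= -norm -!exprM; congr (_ ^+ _).
  apply/eqP; rewrite -(eqn_pmul2r l0) -mulnA divnK // -!mulnA divnK //.
  by rewrite /Q predn_exp /geom_sum mulnC [(#|F|.-1 * _)%N]mulnC.
have P0 : b != 0 -> P != 0.
  apply: contraNneq => P0; move: norm; rewrite P0 scale0r => /eqP.
  by rewrite !expf_eq0 => /and3P[].
rewrite (irreducible_adjoin_degree mh hb) sh; split.
  move=> deg l pl ld; apply/negP => Pl.
  have ld0 : (0 < d %/ l)%N by rewrite divn_gt0 ?prime_gt0 // dvdn_leq.
  (* otherwise the degree of b over F would be at most r * (d / l) *)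
  suff : b ^+ (#|F| ^ (r * (d %/ l))) == b.
    rewrite expr_card_fix deg dvdn_pmul2l // => /dvdn_leq => /(_ ld0).
    by rewrite leqNgt ltn_Pdiv // prime_gt1.
  have [->|b0] := eqVneq b 0; first by rewrite expr0n gtn_eqF // expn_gt0 ltnW.
  rewrite expnM expr_pow_fix // ?(ltnW Q1) //.
  have /dvdnP[k ->] : (d %/ l %| geom_sum Q (d %/ l))%N.
    apply: dvdn_geom_sum_self => // p pp pd; apply: hQ => //.
    exact: dvdn_trans pd (dvdn_div _).
  move: Pl; rewrite in_powers ?hq ?P0 // => /eqP P1.
  by rewrite mulnC exprM zE ?hq // P1 scale1r expr1n.
move=> hP.
have b0 : b != 0.
  apply: contraNneq (hP _ (pdiv_prime d1) (pdiv_dvd d)) => b0.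
  have -> : P = 0.
    apply: (fmorph_inj (in_alg L)); rewrite rmorph0 /= -norm b0.
    rewrite expr0n gtn_eqF // expr0n gtn_eqF // /geom_sum.
    by rewrite -(prednK r0) big_ord_recl.
  by apply/imsetP; exists 0; rewrite // expr0n gtn_eqF // pdiv_gt0.
have zprim : d.-primitive_root (b ^+ Q.-1).
  apply: primitive_root_prime_test => // [|l pl ld].
    have := zE 1%N (dvd1n _) (dvd1n _); rewrite !divn1 => ->.
    by rewrite expf_card_pred ?P0 // scale1r.
  rewrite zE ?hq // -[X in X != _]/(in_alg L _) fmorph_eq1.
  by rewrite -in_powers ?hq ?P0 // hP.
apply/eqP; rewrite eqn_dvd -expr_card_fix expnM expr_pow_fix ?(ltnW Q1) //.
rewrite -(prim_order_dvd zprim) dvdn_geom_sum_self //=.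
set N := adjoin_degree _ _.
have bN : b ^+ (#|F| ^ N) = b by apply/eqP; rewrite expr_card_fix.
(* x is a polynomial in b, so the Frobenius power fixing b fixes x *)
have /dvdnP[t EN] : (r %| N)%N.
  rewrite -degx -expr_card_fix /x exprDn_card -exprM mulnC exprM bN.
  by rewrite -scaleNr in_algX_card.
rewrite EN mulnC dvdn_pmul2r //; apply: (dvdn_geom_sum Q1) => //.
rewrite (prim_order_dvd zprim) -expr_pow_fix ?(ltnW Q1) //.
by rewrite /Q -expnM mulnC -EN bN.
Qed.

(** * Iterates of X^d - a *)

Section Iterates.

Variables (K : fieldType) (d : nat) (a : K).
Hypothesis d0 : (0 < d)%N.
Let f : {poly K} := 'X^d - a%:P.

Lemma poly_iter_monic n : poly_iter f n \is monic.
Proof.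
elim: n => [|n IH] /=; first exact: monicX.
rewrite monicE lead_coef_comp ?size_XnsubC // lead_coefXnsubC //.
by rewrite (monicP IH) mul1r expr1n.
Qed.

Lemma size_poly_iter n : size (poly_iter f n) = (d ^ n).+1.
Proof.
have s0 : (0 < size (poly_iter f n))%N.
  by rewrite size_poly_gt0 monic_neq0 // poly_iter_monic.
rewrite -(prednK s0); congr _.+1.
elim: n {s0} => [|n IH] /=; first by rewrite size_polyX.
by rewrite size_comp_poly IH size_XnsubC // expnSr.
Qed.

Lemma poly_iterSr n : poly_iter f n.+1 = f \Po poly_iter f n.
Proof.
elim: n => [|n IH]; first by rewrite /= comp_polyX comp_polyXr.
by rewrite -[LHS]/(poly_iter f n.+1 \Po f) {1}IH -comp_polyA.
Qed.

Lemma Pseq_rec n :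
  (Pseq K d n.+2).[a] = (Pseq K d n.+1).[a] ^+ d + (-1) ^+ d.-1 * a.
Proof. by rewrite {1}/Pseq /= !hornerE. Qed.

(** The orbit of -a, which is the orbit of the critical value, satisfies the
    recursion of [Pseq] up to a sign; with this sign the value is the norm of
    [norm_addr_root] for the n-th iterate. *)
Lemma Pseq_poly_iter n :
  (Pseq K d n.+1).[a] = (-1) ^+ (d ^ n) * (poly_iter f n).[- a].
Proof.
elim: n => [|n IH]; first by rewrite /Pseq /= !hornerX expr1 mulN1r opprK.
have sgn : (-1) ^+ (d ^ n.+1) = - (-1) ^+ d.-1 :> K.
  by rewrite -signr_odd oddX /= signr_odd -{1}(prednK d0) exprS mulN1r.
rewrite Pseq_rec IH poly_iterSr horner_comp !hornerE exprMn -exprM -expnSr.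
by rewrite mulrBr [in X in _ - X]sgn mulNr opprK.
Qed.

End Iterates.

(** If a = b^l then X^(d/l) - b is a proper factor. *)
Lemma irreducible_XnsubC_notin_powers (F : finFieldType) (d l : nat) (a : F) :
  (0 < d)%N -> irreducible_poly ('X^d - a%:P) -> prime l -> (l %| d)%N ->
  a \notin powers F l.
Proof.
move=> d0 [_ irr] pl ld; apply/imsetP => -[b _ Ea].
have ld0 : (0 < d %/ l)%N by rewrite divn_gt0 ?prime_gt0 // dvdn_leq.
have /eqp_size : 'X^(d %/ l) - b%:P %= 'X^d - a%:P.
  apply: irr; first by rewrite size_XnsubC // -(prednK ld0).
  by rewrite Ea -{2}(divnK ld) exprM rmorphXn subrXX dvdp_mulr.
rewrite !size_XnsubC // => -[E].
by have := ltn_Pdiv (prime_gt1 pl) d0; rewrite E ltnn.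
Qed.

(** The hypothesis on a = P_1(a) forces every prime divisor l of d to divide
    q - 1, since otherwise all elements of F are l-th powers. *)
Lemma irreducible_iff_powers (F : finFieldType) (d n : nat) (a : F) :
  (1 < d)%N -> ~~ (4 %| d)%N ->
  (forall l, prime l -> (l %| d)%N -> a \notin powers F l) ->
  irreducible_poly (poly_iter ('X^d - a%:P) n) ->
  irreducible_poly (poly_iter ('X^d - a%:P) n.+1) <->
  (forall l, prime l -> (l %| d)%N -> (Pseq F d n.+1).[a] \notin powers F l).
Proof.
move=> d1 d4 ha irr; have d0 := ltnW d1.
rewrite Pseq_poly_iter //; have := size_poly_iter a d0 n => sn.
have := irreducible_comp_XnsubC a d1 d4 _ (poly_iter_monic a d0 n) irr.
rewrite sn; apply=> l pl ld; apply: contraNT (ha l pl ld) => nl.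
exact: powers_full.
Qed.

(** Each term determines the next one, so once u n = u m the terms cycle
    through those of index below m. *)
Lemma repetition_values (T : Type) (u : nat -> T) (g : T -> T) (n m k : nat) :
  (forall i, (0 < i)%N -> u i.+1 = g (u i)) ->
  (0 < n < m)%N -> u n = u m -> (0 < k)%N ->
  exists2 j, (0 < j < m)%N & u k = u j.
Proof.
move=> rec /andP[n0 nm] E; elim: k => // k IH _.
case: (posnP k) => [->|k0]; first by exists 1%N; rewrite //; lia.
have [j /andP[j0 jm] Ej] := IH k0.
have [jm'|jm'] := ltnP j.+1 m; first by exists j.+1; rewrite ?jm' // !rec // Ej.
exists n; first by rewrite n0.
by rewrite rec // Ej -rec // E; congr u; lia.
Qed.

Theorem theorem1 (F : finFieldType) (d : nat) (a : F) (n0 m0 : nat)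
  (hd : (2 <= d)%N) (hd4 : ~~ (4 %| d)%N)
  (hnm : first_repetition (fun n : nat => (Pseq F d n).[a]) n0 m0) :
  stable ('X^d - a%:P) <->
  (forall l : nat, prime l -> (l %| d)%N ->
   forall k : nat, (1 <= k <= m0 - 1)%N ->
   (Pseq F d k).[a] \notin powers F l).
Proof.
have d0 := ltnW hd; have [n0m0 E _ _] := hnm.
split=> [st l pl ld [//|k] _ | hP].
  have step := irreducible_iff_powers hd hd4 _ (st k).
  apply: (iffLR (step _) (st k.+1)) => // p pp pd.
  apply: irreducible_XnsubC_notin_powers pp pd => //.
  by have := st 1%N; rewrite /= comp_polyX.
have hall l k : prime l -> (l %| d)%N -> (Pseq F d k.+1).[a] \notin powers F l.
  move=> pl ld.
  have [|j jm ->] := @repetition_values _ (fun n => (Pseq F d n).[a])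
    (fun y => y ^+ d + (-1) ^+ d.-1 * a) n0 m0 k.+1 _ n0m0 E isT.
    by move=> [//|i] _; apply: Pseq_rec.
  by apply: hP => //; lia.
elim=> [|n IH]; first by have := irredp_XsubC (0 : F); rewrite subr0.
apply/irreducible_iff_powers => // [p pp pd|l]; last exact: hall.
by have := hall p 0%N pp pd; rewrite /Pseq /= hornerX.
Qed.
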